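(* Let $\mathcal{G}$ be a graded $\mathbb{C}[\partial]$-module. Then a $Leib_\infty$-conformal algebra structure on $\mathcal{G}$ is equivalent to a Maurer-Cartan element in the graded Lie algebra $(C^\bullet_{cs}(\mathcal{G}[-1]),[\![\cdot,\cdot]\!])$. That is, the assignment $\{\rho_k\}_{k\ge1}\mapsto\varrho=\sum_{k\ge1}\varrho_k$ with $\varrho_k=(-1)^{\frac{k(k-1)}{2}}\,s\circ\rho_k\circ(s^{-1})^{\otimes k}$ is a one-to-one correspondence between $Leib_\infty$-conformal algebra structures on $\mathcal{G}$ and elements $\varrho\in C^{-1}_{cs}(\mathcal{G}[-1])$ with $[\![\varrho,\varrho]\!]=0$.
   Context: Tensor products are over $\mathbb{C}$. For a graded $\mathbb{C}[\partial]$-module $\mathcal{G}=\oplus_{i\in\mathbb{Z}}\mathcal{G}_i$, the space $\mathcal{G}[[\lambda_1,\ldots,\lambda_{k-1}]]$ is graded by $\oplus_i\mathcal{G}_i[[\lambda_1,\ldots,\lambda_{k-1}]]$, with $\partial$ acting coefficientwise; multilinear operations are extended coefficientwise to formal power series arguments. The shift is $(\mathcal{G}[-1])_i=\mathcal{G}_{i-1}$; $s:\mathcal{G}\to\mathcal{G}[-1]$ is the degree $+1$ identification and $s^{-1}$ its inverse (degree $-1$); $(s^{-1})^{\otimes k}$ is applied with the Koszul sign rule, and $s$ acts coefficientwise on power series. Conformal sesquilinear map: a $\mathbb{C}$-linear map $\varphi:\mathcal{H}^{\otimes k}\to\mathcal{H}[[\lambda_1,\ldots,\lambda_{k-1}]]$,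 written $\varphi_{\lambda_1,\ldots,\lambda_{k-1}}(h_1,\ldots,h_k)$, such that $\varphi_{\lambda_1,\ldots,\lambda_{k-1}}(h_1,\ldots,\partial h_i,\ldots,h_k)=-\lambda_i\,\varphi_{\lambda_1,\ldots,\lambda_{k-1}}(h_1,\ldots,h_k)$ for $1\le i\le k-1$, and $\varphi_{\lambda_1,\ldots,\lambda_{k-1}}(h_1,\ldots,h_{k-1},\partial h_k)=(\partial+\lambda_1+\cdots+\lambda_{k-1})\varphi_{\lambda_1,\ldots,\lambda_{k-1}}(h_1,\ldots,h_k)$. $\mathrm{Sh}(i-1,l-1)$ is the set of $(i-1,l-1)$-shuffles, i.e. permutations $\sigma$ of $\{1,\ldots,i+l-2\}$ with $\sigma(1)<\cdots<\sigma(i-1)$ and $\sigma(i)<\cdots<\sigma(i+l-2)$; $\varepsilon(\sigma)$ is the Koszul sign of $\sigma$ acting on the homogeneous elements involved and $\mathrm{sgn}(\sigma)$ the signature. A $Leib_\infty$-conformal algebra structure on $\mathcal{G}$ is a collection of conformal sesquilinear maps $\rho_k:\mathcal{G}^{\otimes k}\to\mathcal{G}[[\lambda_1,\ldots,\lambda_{k-1}]]$, $k\ge1$, with $\deg(\rho_k)=k-2$, such that for each $n\ge1$ and homogeneous $x_1,\ldots,x_n\in\mathcal{G}$, $$\sum_{k+l=n+1}\sum_{i=1}^k\sum_{\sigma\in\mathrm{Sh}(i-1,l-1)}\varepsilon(\sigma)\,\mathrm{sgn}(\sigma)(-1)^{(k-i-1)(l-1)}(-1)^{l(|x_{\sigma(1)}|+\cdots+|x_{\sigma(i-1)}|)}(\rho_k)_{\lambda_{\sigma(1)},\ldots,\lambda_{\sigma(i-1)},\lambda_{\sigma(i)}+\cdots+\lambda_{\sigma(i+l-2)}+\lambda_{i+l-1},\lambda_{i+l},\ldots,\lambda_{n-1}}\big(x_{\sigma(1)},\ldots,x_{\sigma(i-1)},(\rho_l)_{\lambda_{\sigma(i)},\ldots,\lambda_{\sigma(i+l-2)}}(x_{\sigma(i)},\ldots,x_{\sigma(i+l-2)},x_{i+l-1}),x_{i+l},\ldots,x_n\big)=0,$$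 where, when $i=k$, the subscript list of the outer map consists only of $\lambda_{\sigma(1)},\ldots,\lambda_{\sigma(k-1)}$. Let $\mathcal{H}$ be a graded $\mathbb{C}[\partial]$-module. For conformal sesquilinear $\varphi_k$ ($k$ inputs) and $\psi_l$ ($l$ inputs, degree $m$) and $p=k+l-1$, define $$(\varphi_k\diamond\psi_l)_{\lambda_1,\ldots,\lambda_{p-1}}(h_1,\ldots,h_p)=\sum_{i=1}^k\sum_{\sigma\in\mathrm{Sh}(i-1,l-1)}\varepsilon(\sigma)(-1)^{m(|h_{\sigma(1)}|+\cdots+|h_{\sigma(i-1)}|)}(\varphi_k)_{\lambda_{\sigma(1)},\ldots,\lambda_{\sigma(i-1)},\lambda_{\sigma(i)}+\cdots+\lambda_{\sigma(i+l-2)}+\lambda_{i+l-1},\lambda_{i+l},\ldots,\lambda_{p-1}}\big(h_{\sigma(1)},\ldots,h_{\sigma(i-1)},(\psi_l)_{\lambda_{\sigma(i)},\ldots,\lambda_{\sigma(i+l-2)}}(h_{\sigma(i)},\ldots,h_{\sigma(i+l-2)},h_{i+l-1}),h_{i+l},\ldots,h_p\big),$$ with the same subscript convention when $i=k$. $C^n_{cs}(\mathcal{H})$ is the space of formal sums $\sum_{k\ge1}\varphi_k$ with $\varphi_k:\mathcal{H}^{\otimes k}\to\mathcal{H}[[\lambda_1,\ldots,\lambda_{k-1}]]$ conformal sesquilinear of degree $n$. The graded space $C^\bullet_{cs}(\mathcal{H})=\oplus_{n\in\mathbb{Z}}C^n_{cs}(\mathcal{H})$ is a graded Lie algebra with bracket,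 for $\varphi=\sum_k\varphi_k\in C^n_{cs}(\mathcal{H})$, $\psi=\sum_l\psi_l\in C^m_{cs}(\mathcal{H})$, $$[\![\varphi,\psi]\!]=\sum_{p\ge1}\sum_{k+l=p+1}\big(\varphi_k\diamond\psi_l-(-1)^{mn}\psi_l\diamond\varphi_k\big).$$ A Maurer-Cartan element is $\varrho\in C^{-1}_{cs}(\mathcal{H})$ with $[\![\varrho,\varrho]\!]=0$. *)

(* Defs.v *)
From HB Require Import structures.
From mathcomp Require Import all_boot all_order all_algebra all_fingroup.
From mathcomp Require Import boolp classical_sets functions cardinality fsbigop.
From mathcomp Require Import reals.
From mathcomp Require Import complex.
From mathcomp Require Import mpoly.

Set Implicit Arguments.
Unset Strict Implicit.
Unset Printing Implicit Defensive.

Import GRing.Theory.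
Local Open Scope classical_set_scope.
Local Open Scope ring_scope.

(* The Z-grading is an internal direct sum decomposition: [gcomp i] is the
   subspace of elements that are homogeneous of degree i (0 is homogeneous of
   every degree), and every element is, in a unique way, a finitely supported
   sum of homogeneous elements. *)
Record gradedModule (R : realType) := GradedModule {
  gcarrier :> lmodType R[i];
  gder : {linear gcarrier -> gcarrier};
  gcomp : int -> set gcarrier;
  gcomp0 : forall i, gcomp i 0;
  gcompP : forall i (a : R[i]) u v,
    gcomp i u -> gcomp i v -> gcomp i (a *: u + v);
  gcomp_der : forall i u, gcomp i u -> gcomp i (gder u);
  gdirect : forall x : gcarrier, exists! f : int -> gcarrier,
    [/\ forall i, gcomp i (f i),
        finite_set [set i | f i != 0]
      & x = \sum_(i \in [set: int]) f i] }.

Section Graded.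
Variables (R : realType) (H : gradedModule R).

Definition hcomp (i : int) (x : H) : H := sval (cid (gdirect x)) i.

(* H[[lambda_1, ..., lambda_n]]; the value at a multi-index is the coefficient
   of the corresponding monomial. *)
Definition pseries (n : nat) := 'X_{1..n} -> H.

Definition mulvar n (i : 'I_n) (f : pseries n) : pseries n :=
  fun m => if m i == 0%N then 0 else f (m - U_(i))%MM.

(* Maps are indexed by the number k of formal variables, so a [cmap k] has
   k + 1 arguments. Arguments and variables are numbered from 0. *)
Definition cmap (k : nat) := ('I_k.+1 -> H) -> pseries k.

Definition multilinear k (phi : cmap k) : Prop :=
  forall (i : 'I_k.+1) (h : 'I_k.+1 -> H) (a : R[i]) (u v : H) m,
    phi [eta h with i |-> a *: u + v] m =
    a *: phi [eta h with i |-> u] m + phi [eta h with i |-> v] m.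

Definition conformal_sesquilinear k (phi : cmap k) : Prop :=
  [/\ multilinear phi,
      forall (i : 'I_k) (h : 'I_k.+1 -> H) m,
        let i' := widen_ord (leqnSn k) i in
        phi [eta h with i' |-> gder H (h i')] m = - mulvar i (phi h) m
    & forall (h : 'I_k.+1 -> H) m,
        phi [eta h with ord_max |-> gder H (h ord_max)] m =
        gder H (phi h m) + \sum_(i < k) mulvar i (phi h) m].

Definition homogeneous p (d : 'I_p -> int) (h : 'I_p -> H) : Prop :=
  forall j, gcomp (d j) (h j).

Definition has_degree (n : int) k (phi : cmap k) : Prop :=
  forall (d : 'I_k.+1 -> int) (h : 'I_k.+1 -> H), homogeneous d h ->
  forall m, gcomp (\sum_j d j + n) (phi h m).

(* Linear extension of a formula F d h, meaningful for h homogeneous of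
   degrees d, to arbitrary arguments. If F d is multilinear, only finitely many
   terms are nonzero. *)
Definition hom_extend k (F : {ffun 'I_k.+1 -> int} -> cmap k) : cmap k :=
  fun h m =>
    \sum_(d \in [set: {ffun 'I_k.+1 -> int}]) F d (fun j => hcomp (d j) (h j)) m.

(* In what follows a permutation s of {0, ..., n-1} acts on all naturals,
   fixing those >= n. *)
Definition pext n (s : 'S_n) (j : nat) : nat :=
  oapp (fun u : 'I_n => val (s u)) j (insub j).

Definition shuffle (a b : nat) : {set 'S_(a + b)} :=
  [set s : 'S_(a + b) | [forall u : 'I_(a + b), forall v : 'I_(a + b),
    (u < v)%N && ((v < a)%N || (a <= u)%N) ==> (s u < s v)%N]].

(* s sends x_0 ... x_(n-1) to x_(s 0) ... x_(s (n-1)), with |x_j| = d j. *)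
Definition koszul n (s : 'S_n) (d : nat -> int) : R[i] :=
  \prod_(u < n) \prod_(v < n | (u < v)%N && (s v < s u)%N)
    (-1) ^ (d (s u) * d (s v)).

(* The default value is never used: j < p in all the uses below. *)
Definition lam p (j : nat) : {mpoly R[i][p]} :=
  if insub j is Some v then 'X_v else 0.

(* For F = F_mu : H -> H[[mu_1, ..., mu_k]] and g in H[[nu_1, ..., nu_l]], this
   is F_mu(g), with F extended coefficientwise, after the substitutions
   mu_j := L j and nu_j := M j. As L and M have no constant term, only
   multi-indices of degree <= |m| contribute to the coefficient of m. *)
Definition compose_subst p k l
    (L : 'I_k -> {mpoly R[i][p]}) (M : 'I_l -> {mpoly R[i][p]})
    (F : H -> pseries k) (g : pseries l) : pseries p :=
  fun m => \sum_(b : 'X_{1..l < (mdeg m).+1})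
           \sum_(a : 'X_{1..k < (mdeg m).+1})
             (mmap1 L a * mmap1 M b)@_m *: F (g b) a.

(* The subscripts of the outer map. Slot i carries the sum of the subscripts of
   the inner map and of the variable attached to its last argument; there is no
   such subscript when i = k. *)
Definition outer_var p k l i (s : 'S_(i + l)) (j : 'I_k) : {mpoly R[i][p]} :=
  if (j < i)%N then lam p (pext s j)
  else if (j == i :> nat) then \sum_(u < l.+1) lam p (pext s (i + u))
  else lam p (j + l).

Definition outer_arg p k l i (s : 'S_(i + l)) (h : 'I_p.+1 -> H) (v : H)
    (j : 'I_k.+1) : H :=
  if (j < i)%N then h (inord (pext s j))
  else if (j == i :> nat) then v
  else h (inord (j + l)).

(* phi(h_(s 0), ..., h_(s (i-1)),
       psi(h_(s i), ..., h_(s (i+l-1)), h_(i+l)), h_(i+l+1), ..., h_p),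
   used for k + l = p only. *)
Definition insertion p k l i (s : 'S_(i + l)) (phi : cmap k) (psi : cmap l) :
    cmap p :=
  fun h => compose_subst
    (outer_var p s) (fun j : 'I_l => lam p (pext s (i + j)))
    (fun v => phi (outer_arg s h v))
    (psi (fun j => h (inord (pext s (i + j))))).

(* |h_(s 0)| + ... + |h_(s (i-1))| *)
Definition deg_before p l i (s : 'S_(i + l)) (d : 'I_p.+1 -> int) : int :=
  \sum_(j < i) d (inord (pext s j)).

(* phi diamond psi, for psi of degree n; used for k + l = p only. *)
Definition diamond p k l (n : int) (phi : cmap k) (psi : cmap l) : cmap p :=
  hom_extend (fun d h m =>
    \sum_(i < k.+1) \sum_(s in shuffle i l)
      (koszul s (fun j => d (inord j)) * (-1) ^ (n * deg_before s d))
        *: insertion s phi psi h m).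

(* Formal sums of maps. *)
Definition family := forall k : nat, cmap k.

Definition Ccs (n : int) : set family :=
  [set phi | forall k, conformal_sesquilinear (phi k) /\ has_degree n (phi k)].

(* The bracket of phi in Ccs n and psi in Ccs m. *)
Definition bracket (n m : int) (phi psi : family) : family :=
  fun p h c => \sum_(k < p.+1) \sum_(l < p.+1 | (k + l == p)%N)
    (@diamond p k l m (phi k) (psi l) h c
     - (-1) ^ (m * n) *: @diamond p l k n (psi l) (phi k) h c).

Definition MaurerCartan : set family :=
  [set phi | Ccs (-1) phi /\
     forall p h m, @bracket (-1) (-1) phi phi p h m = 0].

(* With k, l, i and n shifted by one, the degree "arity - 2" is k - 1, and the
   sign (-1)^((k-i-1)(l-1)) becomes (-1)^((k-i-1) l). *)
Definition LeibInfConformal : set family :=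
  [set rho |
     (forall k, conformal_sesquilinear (rho k)
                /\ has_degree (k%:Z - 1) (rho k)) /\
     forall n (d : 'I_n.+1 -> int) (x : 'I_n.+1 -> H), homogeneous d x ->
     forall m,
       \sum_(k < n.+1) \sum_(l < n.+1 | (k + l == n)%N)
       \sum_(i < k.+1) \sum_(s in shuffle i l)
         (koszul s (fun j => d (inord j)) * (-1) ^+ s
          * (-1) ^ ((k%:Z - i%:Z - 1) * l%:Z)
          * (-1) ^ (l.+1%:Z * deg_before s d))
           *: @insertion n k l i s (rho k) (rho l) x m = 0].

End Graded.

Arguments MaurerCartan {R} H.
Arguments LeibInfConformal {R} H.

Section Shift.
Variables (R : realType) (G : gradedModule R).

Lemma shift_direct (x : G) : exists! f : int -> G,
  [/\ forall i, gcomp (i - 1) (f i),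
      finite_set [set i | f i != 0]
    & x = \sum_(i \in [set: int]) f i].
Proof.
have [f [[fG ffin fx] funiq]] := gdirect x.
have dbij (c : int) : bijective (fun i : int => i - c).
  by exists (fun i => i + c) => i /=; rewrite ?subrK ?addrK.
have reG (c : int) (g : int -> G) : finite_set [set i | g i != 0] ->
    finite_set [set i | g (i - c) != 0].
  move=> gfin; apply: (@sub_finite_set _ _ ((fun i => i + c) @`
    [set i | g i != 0])); last exact: finite_image.
  by move=> i /= gi; exists (i - c); rewrite ?subrK.
exists (fun i => f (i - 1)); split=> [|g [gG gfin gx]].
  split=> [i||]; [exact: fG | exact: reG |].
  by rewrite {1}fx (reindex_fsbigT _ _ (dbij 1)).
apply/funext => i.
have -> : f = (fun i => g (i - -1)).
  apply: funiq; split=> [j||].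
  - by have := gG (j - -1); rewrite opprK addrK.
  - exact: reG.
  - by rewrite {1}gx (reindex_fsbigT _ _ (dbij (-1))).
by rewrite opprK subrK.
Qed.

(* (G[-1])_i = G_(i-1) *)
Definition gshift : gradedModule R :=
  @GradedModule R G (gder G) (fun i => gcomp (i - 1))
    (fun i => gcomp0 G (i - 1)) (fun i => @gcompP R G (i - 1))
    (fun i => @gcomp_der R G (i - 1)) shift_direct.

Definition susp : G -> gshift := id.
Definition desusp : gshift -> G := id.

(* (s^-1)^(⊗ n) (h_0 ⊗ ... ⊗ h_(n-1)) is desusp_sign d times
   s^-1 h_0 ⊗ ... ⊗ s^-1 h_(n-1): the b-th factor s^-1, of degree -1, moves past
   the h_a with a < b. *)
Definition desusp_sign n (d : 'I_n -> int) : R[i] :=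
  \prod_(b < n) \prod_(a < n | (a < b)%N) (-1) ^ (-1 * d a).

Definition shifted_family (rho : family G) : family gshift :=
  fun k => hom_extend (fun d h m =>
    ((-1) ^+ (k.+1 * k)./2 * desusp_sign d)
      *: susp (rho k (fun j => desusp (h j)) m)).

End Shift.

Arguments shifted_family {R} G.

(* Main.v *)
(* Both structures are families of conformal sesquilinear maps on the same
   underlying module, and rho |-> varrho multiplies rho_k on homogeneous
   arguments by a sign, so it is an involution. As [[varrho, varrho]] is twice
   the sum of the varrho_k <> varrho_l, it remains to see that for fixed
   homogeneous arguments each shuffle term of varrho_k <> varrho_l is the
   corresponding term of the Leib_infty identity up to a sign which depends
   only on p = k + l and on the degrees. Raising all degrees by one changes the
   Koszul sign of s by sgn(s) and by (-1)^(d_a + d_b) for every inversion, and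
   modulo 2 the exponents of the latter sum up to sum_u d_(s u) (s u - u), which
   is the change of the sign of (s^-1)^(⊗ p+1) under s. *)
Require Import Defs.
From mathcomp Require Import all_boot all_order all_algebra all_fingroup.
From mathcomp Require Import boolp classical_sets functions cardinality fsbigop.
From mathcomp Require Import reals complex mpoly zify ring.

Set Implicit Arguments.
Unset Strict Implicit.
Unset Printing Implicit Defensive.

Import GRing.Theory Num.Theory.
Local Open Scope classical_set_scope.
Local Open Scope ring_scope.

(** * Homogeneous components in a graded module *)

Section Homogeneous.
Variables (R : realType) (H : gradedModule R).
Implicit Types x u v : H.

Lemma hcompP x : [/\ forall i, gcomp i (hcomp i x),
  finite_set [set i | hcomp i x != 0] & x = \sum_(i \in [set: int]) hcomp i x].
Proof. by rewrite /hcomp; case: cid => f [/= ? _]. Qed.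

Lemma hcomp_uniq x (f : int -> H) : (forall i, gcomp i (f i)) ->
  finite_set [set i | f i != 0] -> x = \sum_(i \in [set: int]) f i ->
  forall i, hcomp i x = f i.
Proof. by rewrite /hcomp; case: cid => g [/= _ gu] *; rewrite (gu f). Qed.

(** Allowing any finite [D] that contains the support lets several finitely supported sums be
    written over one common list and compared termwise. *)
Lemma fsbig_on (I : choiceType) (V : nmodType) (D : set I) (f : I -> V) :
  finite_set D -> (forall i, ~ D i -> f i = 0) ->
  \sum_(i \in [set: I]) f i = \sum_(i <- finmap.enum_fset (fset_set D)) f i.
Proof.
move=> Dfin f0; rewrite -(fsbig_finite _ _ Dfin).
by apply/esym/fsbig_widen => // i [_ /f0].
Qed.

Lemma hcompD a u v i : hcomp i (a *: u + v) = a *: hcomp i u + hcomp i v.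
Proof.
have [uG ufin ue] := hcompP u; have [vG vfin ve] := hcompP v.
pose D := [set i | hcomp i u != 0] `|` [set i | hcomp i v != 0].
have Dfin : finite_set D by rewrite finite_setU.
have D0 j : ~ D j -> hcomp j u = 0 /\ hcomp j v = 0.
  by move=> /not_orP[/negP/negPn/eqP -> /negP/negPn/eqP ->].
have D0' j : ~ D j -> a *: hcomp j u + hcomp j v = 0.
  by move=> /D0[-> ->]; rewrite scaler0 addr0.
apply: (@hcomp_uniq _ (fun i => a *: hcomp i u + hcomp i v)) => [j||].
- exact: gcompP.
- apply: sub_finite_set Dfin => j /= /eqP; apply: contra_notP; exact: D0'.
rewrite {1}ue {1}ve !(fsbig_on Dfin) //; last 2 first.
- by move=> j /D0[].
- by move=> j /D0[].
by rewrite scaler_sumr big_split.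
Qed.

Lemma hcomp_der x i : hcomp i (gder H x) = gder H (hcomp i x).
Proof.
have [xG xfin xe] := hcompP x.
have D0 j : ~ [set i | hcomp i x != 0] j -> hcomp j x = 0.
  by move=> /negP/negPn/eqP.
apply: (@hcomp_uniq _ (fun i => gder H (hcomp i x))) => [j||].
- exact: gcomp_der.
- by apply: sub_finite_set xfin => j /=; apply: contraNN => /eqP ->; rewrite linear0.
rewrite {1}xe !(fsbig_on xfin) // ?raddf_sum // => j /D0 ->; exact: linear0.
Qed.

Lemma hcomp_hom x i j : gcomp i x -> hcomp j x = if j == i then x else 0.
Proof.
move=> xi; have D0 l : ~ [set i] l -> (if l == i then x else 0) = 0.
  by case: eqP.
apply: (@hcomp_uniq _ (fun j => if j == i then x else 0)) => [l||].
- by case: eqP => [->//|_]; exact: gcomp0.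
- by apply: sub_finite_set (finite_set1 i) => l /=; case: (l =P i) => //; rewrite eqxx.
by rewrite (fsbig_on (finite_set1 i)) // fset_set1 finmap.big_seq_fset1 eqxx.
Qed.

Lemma gcompZ i a x : gcomp i x -> gcomp i (a *: x).
Proof. by move=> xi; rewrite -[_ *: _]addr0; apply: gcompP => //; exact: gcomp0. Qed.

End Homogeneous.

(** * Multilinear maps and their twists by scalars depending on the degrees *)

Section Multilinear.
Variables (R : realType) (H : gradedModule R) (k : nat).
Implicit Types (phi psi : cmap H k) (h : 'I_k.+1 -> H).

Lemma multilinearD phi i h u v m : multilinear phi ->
  phi [eta h with i |-> u + v] m =
  phi [eta h with i |-> u] m + phi [eta h with i |-> v] m.
Proof. by move=> /(_ i h 1 u v m); rewrite !scale1r. Qed.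

Lemma multilinear0 phi h j m : multilinear phi -> h j = 0 -> phi h m = 0.
Proof.
move=> ml hj; have := multilinearD j h 0 0 m ml; rewrite addr0.
have -> : [eta h with j |-> 0] = h :> ('I_k.+1 -> H) by apply/funext => l /=; case: eqP => // ->.
by move=> /eqP; rewrite -subr_eq0 opprD addNKr oppr_eq0 => /eqP.
Qed.

Lemma multilinearZ phi i h a u m : multilinear phi ->
  phi [eta h with i |-> a *: u] m = a *: phi [eta h with i |-> u] m.
Proof.
move=> ml; rewrite -[a *: u]addr0 ml.
by rewrite (@multilinear0 phi [eta h with i |-> 0] i) ?addr0 //= eqxx.
Qed.

Lemma multilinear_sum phi i h (I : Type) (r : seq I) (f : I -> H) m :
  multilinear phi ->
  phi [eta h with i |-> \sum_(t <- r) f t] m =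
  \sum_(t <- r) phi [eta h with i |-> f t] m.
Proof.
move=> ml; elim: r => [|t r IH].
  by rewrite !big_nil (@multilinear0 phi [eta h with i |-> 0] i) //= eqxx.
by rewrite !big_cons multilinearD // IH.
Qed.

Lemma multilinear_ext phi psi : multilinear phi -> multilinear psi ->
  (forall d h m, homogeneous d h -> phi h m = psi h m) ->
  forall h m, phi h m = psi h m.
Proof.
move=> mphi mpsi hom.
(* Induction on [r]: the arguments at positions [r] and above are already homogeneous, and the step
   splits the argument at position [r] into its components. *)
suff P r : (r <= k.+1)%N -> forall h m,
    (forall j : 'I_k.+1, (r <= j)%N -> exists e, gcomp e (h j)) ->
    phi h m = psi h m.
  by move=> h m; apply: (P k.+1) => // j; rewrite leqNgt ltn_ord.
elim: r => [|r IH] rk h m hh.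
  have /choice[d dh] : forall j, exists e, gcomp e (h j) by move=> j; exact: hh.
  exact: (hom d).
pose i := Ordinal rk; have [xG xfin xe] := hcompP (h i).
have -> : h = [eta h with i |-> h i].
  by apply/funext => j /=; case: eqP => // ->.
rewrite xe (fsbig_on xfin); last by move=> j /negP/negPn/eqP.
rewrite !multilinear_sum //; apply: eq_bigr => e _; apply: IH => [|j rj].
  exact: ltnW.
rewrite /=; case: eqP => [_|/eqP ji]; first by exists e.
by apply: hh; rewrite ltn_neqAle rj andbT eq_sym.
Qed.

Definition hsupp h : set {ffun 'I_k.+1 -> int} :=
  [set d | forall j, hcomp (d j) (h j) != 0].

Lemma hsupp_finite h : finite_set (hsupp h).
Proof.
have Sfin : finite_set (\bigcup_(j in [set: 'I_k.+1])
    [set e | hcomp e (h j) != 0]).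
  apply: bigcup_finite => [|j _]; first exact: finite_finset.
  by have [] := hcompP (h j).
pose r := finmap.enum_fset (fset_set (\bigcup_(j in [set: 'I_k.+1])
    [set e | hcomp e (h j) != 0])).
(* Every entry of a degree tuple in the support lies in the finite list [r], so the tuple is encoded
   by a tuple of indices into [r]. *)
pose f (g : {ffun 'I_k.+1 -> 'I_(size r)}) :=
  [ffun j => nth 0 r (g j)] : {ffun 'I_k.+1 -> int}.
apply: (@sub_finite_set _ _ (f @` setT)) => [d dh|].
  have dr j : d j \in r.
    by rewrite in_fset_set //; apply/mem_set; exists j => //; exact: dh.
  have ri j : (index (d j) r < size r)%N by rewrite index_mem.
  exists [ffun j => Ordinal (ri j)] => //.
  by apply/ffunP => j; rewrite !ffunE /= nth_index.
exact/finite_image/finite_finset.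
Qed.

(** The part of multilinearity that confines the sum in [hom_extend F h] to the finite set
    [hsupp h]. *)
Definition vanishing (F : {ffun 'I_k.+1 -> int} -> cmap H k) :=
  forall d h m j, h j = 0 -> F d h m = 0.

Lemma hom_extend_on F (D : set {ffun 'I_k.+1 -> int}) h m : vanishing F ->
  finite_set D -> hsupp h `<=` D ->
  hom_extend F h m = \sum_(d <- finmap.enum_fset (fset_set D))
    F d (fun j => hcomp (d j) (h j)) m.
Proof.
move=> F0 Dfin hD; rewrite /hom_extend (fsbig_on Dfin) // => d dD.
have /existsNP[j /negP/negPn/eqP dj] : ~ hsupp h d by move=> /hD.
exact: (F0 _ _ _ j).
Qed.

Lemma hom_extend_hom F d h m : vanishing F ->
  homogeneous (d : {ffun 'I_k.+1 -> int}) h -> hom_extend F h m = F d h m.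
Proof.
move=> F0 dh; rewrite (hom_extend_on _ F0 (finite_set1 d)).
  rewrite fset_set1 finmap.big_seq_fset1; congr (F d _ m).
  by apply/funext => j; rewrite (hcomp_hom _ (dh j)) eqxx.
move=> e eh; apply/ffunP => j; have := eh j.
by rewrite (hcomp_hom _ (dh j)); case: (e j =P d j); rewrite // eqxx.
Qed.

Variable c : {ffun 'I_k.+1 -> int} -> R[i].

(** The general form of [shifted_family], where [c] is the suspension sign. *)
Definition twist phi : cmap H k := hom_extend (fun d h m => c d *: phi h m).

Lemma vanishing_twist phi : multilinear phi ->
  vanishing (fun d h m => c d *: phi h m).
Proof. by move=> ml d h m j hj; rewrite (multilinear0 _ ml hj) scaler0. Qed.

Lemma twist_hom phi (d : {ffun 'I_k.+1 -> int}) h m : multilinear phi ->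
  homogeneous d h -> twist phi h m = c d *: phi h m.
Proof. by move=> ml dh; rewrite /twist (hom_extend_hom _ _ dh) //; exact: vanishing_twist. Qed.

Lemma multilinear_twist phi : multilinear phi -> multilinear (twist phi).
Proof.
move=> ml i h a u v m; have vt := vanishing_twist ml.
pose D := hsupp [eta h with i |-> a *: u + v] `|`
  (hsupp [eta h with i |-> u] `|` hsupp [eta h with i |-> v]).
have Dfin : finite_set D by rewrite !finite_setU; do !split; exact: hsupp_finite.
rewrite /twist !(hom_extend_on _ vt Dfin); [|by move=> ? ?; rewrite /D /=; tauto..].
rewrite scaler_sumr -big_split; apply: eq_bigr => d _ /=.
have E w : (fun j => hcomp (d j) (if j == i then w else h j)) =
    [eta (fun j => hcomp (d j) (h j)) with i |-> hcomp (d i) w].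
  by apply/funext => j /=; case: eqP => // ->.
by rewrite !E hcompD ml scalerDr !scalerA mulrC.
Qed.

(** Since [gder] preserves degrees, it commutes with [hcomp], cannot enlarge the support and leaves
    the scalar [c d] of each term unchanged; both rules then hold term by term. *)
Lemma sesquilinear_twist phi :
  conformal_sesquilinear phi -> conformal_sesquilinear (twist phi).
Proof.
move=> [ml der1 der2]; have vt := vanishing_twist ml.
have E i h (d : {ffun 'I_k.+1 -> int}) :
    (fun j => hcomp (d j) (if j == i then gder H (h i) else h j)) =
    [eta (fun j => hcomp (d j) (h j)) with i |-> gder H (hcomp (d i) (h i))].
  by apply/funext => j /=; case: eqP => // ->; rewrite hcomp_der.
have S i h : hsupp [eta h with i |-> gder H (h i)] `<=` hsupp h.
  move=> d dh j; have := dh j; rewrite /=; case: (j =P i) => // ->.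
  by rewrite hcomp_der; apply: contraNN => /eqP ->; rewrite linear0.
have mulvarE i h m : mulvar i (twist phi h) m =
    \sum_(d <- finmap.enum_fset (fset_set (hsupp h)))
      c d *: mulvar i (phi (fun j => hcomp (d j) (h j))) m.
  rewrite /mulvar; case: eqP => _; first by rewrite big1 // => ? _; rewrite scaler0.
  by rewrite /twist (hom_extend_on _ vt (@hsupp_finite h)).
split; first exact: multilinear_twist.
- move=> i h m /=; rewrite {1}/twist (hom_extend_on _ vt (@hsupp_finite h)); last exact: S.
  rewrite mulvarE -sumrN; apply: eq_bigr => d _.
  by rewrite /= E der1 scalerN.
move=> h m; rewrite {1}/twist (hom_extend_on _ vt (@hsupp_finite h)); last exact: S.
under [in RHS]eq_bigr do rewrite mulvarE.
rewrite /twist (hom_extend_on _ vt (@hsupp_finite h)) // raddf_sum exchange_big /=.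
rewrite -big_split; apply: eq_bigr => d _.
by rewrite /= E der2 scalerDr linearZ scaler_sumr.
Qed.

Lemma twistK phi : multilinear phi -> (forall d, c d * c d = 1) ->
  twist (twist phi) = phi.
Proof.
move=> ml cc; apply/funext => h; apply/funext => m.
have tml := multilinear_twist ml.
apply: multilinear_ext => // [|d {}h {}m dh]; first exact: multilinear_twist.
have dh' : homogeneous [ffun j => d j] h by move=> j; rewrite ffunE.
by rewrite (twist_hom _ tml dh') (twist_hom _ ml dh') scalerA cc scale1r.
Qed.

End Multilinear.

(** * Integer powers of -1 *)

Section Signs.
Variable K : fieldType.

Lemma signzD (a b : int) : (-1) ^ (a + b) = (-1) ^ a * (-1) ^ b :> K.
Proof. by rewrite expfzDr // oppr_eq0 oner_eq0. Qed.

Lemma prod_signz (I : Type) (r : seq I) (P : pred I) (f : I -> int) :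
  \prod_(j <- r | P j) (-1) ^ f j = (-1) ^ (\sum_(j <- r | P j) f j) :> K.
Proof. by rewrite (big_morph _ signzD (expr0z _)). Qed.

(** Congruence of exponents modulo 2 with an explicit quotient [c], which turns sign identities into
    polynomial identities over the integers. *)
Lemma eq_signz (c a b : int) : a = b + c * 2 -> (-1) ^ a = (-1) ^ b :> K.
Proof.
move=> ->; rewrite signzD [c * 2]mulrC -exprz_exp.
by rewrite -[(-1) ^ 2]/((-1) ^+ 2) sqrrN expr1n exp1rz mulr1.
Qed.

Lemma signz_sq (a : int) : (-1) ^ a * (-1) ^ a = 1 :> K.
Proof.
rewrite -signzD (@eq_signz a _ 0) ?expr0z //; lia.
Qed.

End Signs.

(* Permuting the columns of the Vandermonde matrix of 0, ..., n-1 multiplies its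
   determinant, a product of differences, by the sign of s. *)
Lemma perm_sign_inversions n (s : 'S_n) : (-1) ^+ s =
  \prod_(u < n) \prod_(v < n | (u < v)%N && (s v < s u)%N) (-1) :> int.
Proof.
pose a : 'rV[int]_n := \row_j (j : nat)%:Z.
have := det_Vandermonde (col_perm s a).
have -> : Vandermonde n (col_perm s a) = col_perm s (Vandermonde n a).
  by apply/matrixP => i j; rewrite !mxE.
(* Taking signs discards the sizes of the differences: those of the unpermuted nodes are all
   positive, and a permuted one is negative exactly at an inversion. *)
rewrite col_permE det_mulmx det_perm odd_permV det_Vandermonde => /(congr1 Num.sg).
have sgprod (f : 'I_n -> 'I_n -> int) :
    Num.sg (\prod_(i < n) \prod_(j < n | (i < j)%N) f i j) =
    \prod_(i < n) \prod_(j < n | (i < j)%N) Num.sg (f i j).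
  rewrite (big_morph _ (@sgrM _) (sgr1 _)); apply: eq_bigr => i _.
  by rewrite (big_morph _ (@sgrM _) (sgr1 _)).
rewrite sgrM !sgprod [X in X * _]big1 ?mul1r => [|i _]; last first.
  by rewrite big1 // => j ij; rewrite !mxE gtr0_sg // subr_gt0 ltz_nat.
have -> : Num.sg ((-1) ^+ s : int) = (-1) ^+ s by case: (odd_perm s).
move=> ->; apply: eq_bigr => u _.
rewrite big_mkcondr; apply: eq_bigr => v uv; rewrite !mxE.
case: ltnP => [vu|]; first by rewrite ltr0_sg // subr_lt0 ltz_nat.
rewrite leq_eqVlt => /orP[/eqP/val_inj/perm_inj uv'|uv'].
  by rewrite uv' ltnn in uv.
by rewrite gtr0_sg // subr_gt0 ltz_nat.
Qed.

Lemma sum_lt_ord n m : (m <= n)%N -> \sum_(v < n | (v < m)%N) (1 : int) = m.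
Proof.
move=> mn; rewrite -(big_ord_widen n (fun=> 1 : int) mn) sumr_const card_ord.
by rewrite -mulr_natl mulr1 natz.
Qed.

(** * Counting inversions *)

Section Inversions.
Variables (n : nat) (s : 'S_n).

Lemma sum_lt_perm (m : nat) : (m <= n)%N ->
  \sum_(v < n | (s v < m)%N) (1 : int) = m.
Proof. by move=> mn; rewrite -[RHS](sum_lt_ord mn) [RHS](reindex_perm s). Qed.

(* e (s u) occurs once for every inversion containing u. Those with a larger
   position and those with a smaller one differ in number by s u - u. *)
Lemma inversion_sum (e : nat -> int) : exists c : int,
  \sum_(u < n) \sum_(v < n | (u < v)%N && (s v < s u)%N) (e (s u) + e (s v)) =
  \sum_(u < n) e (s u) * ((s u)%:Z - u%:Z) + c * 2.
Proof.
(* [A u] and [B u] count the inversions with [u] as the smaller and as the larger position, [C u]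
   the earlier positions with a smaller value. Sorting the values below [s u] by position gives A +
   C, sorting the positions below [u] by value gives B + C. *)
pose A (u : 'I_n) : int := \sum_(v < n | (u < v)%N && (s v < s u)%N) 1.
pose B (u : 'I_n) : int := \sum_(v < n | (v < u)%N && (s u < s v)%N) 1.
pose C (u : 'I_n) : int := \sum_(v < n | (v < u)%N && (s v < s u)%N) 1.
have suE (u : 'I_n) : (s u : int) = A u + C u.
  rewrite -(sum_lt_perm (ltnW (ltn_ord (s u)))) (bigID (fun v : 'I_n => (u < v)%N)).
  congr (_ + _); apply: eq_bigl => v; rewrite andbC // -leqNgt leq_eqVlt.
  by case: eqP => [/val_inj ->|]; rewrite ?ltnn ?andbF.
have uE (u : 'I_n) : (u : int) = B u + C u.
  rewrite -(sum_lt_ord (ltnW (ltn_ord u))) (bigID (fun v : 'I_n => (s u < s v)%N)).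
  congr (_ + _); apply: eq_bigl => v; rewrite // -leqNgt [(s v <= _)%N]leq_eqVlt.
  by case: eqP => [/val_inj/perm_inj ->|]; rewrite ?ltnn ?andbF.
(* A + B = (A - B) + 2 B, and A - B is [s u - u]. *)
exists (\sum_(u < n) e (s u) * B u).
rewrite mulr_suml -big_split /=.
under eq_bigr do rewrite big_split.
rewrite big_split /= [X in _ + X](exchange_big_dep xpredT) //= -big_split.
apply: eq_bigr => u _ /=; rewrite suE uE.
have -> : \sum_(v < n | (u < v)%N && (s v < s u)%N) e (s u) = e (s u) * A u.
  by rewrite mulr_sumr; under [RHS]eq_bigr do rewrite mulr1.
have -> : \sum_(v < n | (v < u)%N && (s u < s v)%N) e (s u) = e (s u) * B u.
  by rewrite mulr_sumr; under [RHS]eq_bigr do rewrite mulr1.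
ring.
Qed.

End Inversions.

(** * Comparison of the signs before and after suspension *)

Section ShiftSigns.
Variable R : realType.

(** An inversion of elements of degrees x and y contributes (x - 1)(y - 1) + 1 = x y + (x + y) + 2
    (1 - x - y); the terms x + y are added up by [inversion_sum]. *)
Lemma koszul_shift n (s : 'S_n) (e : nat -> int) :
  koszul R s (fun j => e j - 1) * (-1) ^+ s =
  koszul R s e * (-1) ^ (\sum_(u < n) e (s u) * ((s u)%:Z - u%:Z)).
Proof.
have [c cE] := inversion_sum s e.
have -> : (-1) ^+ s = \prod_(u < n) \prod_(v < n | (u < v)%N && (s v < s u)%N)
    (-1) ^ (1 : int) :> R[i].
  have := congr1 (fun z : int => z%:~R : R[i]) (perm_sign_inversions s).
  rewrite rmorph_sign rmorph_prod => ->; apply: eq_bigr => u _.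
  by rewrite rmorph_prod; apply: eq_bigr => v _; rewrite rmorphN rmorph1 expr1z.
rewrite /koszul -big_split /= -(eq_signz _ cE) -prod_signz -big_split /=.
apply: eq_bigr => u _; rewrite -prod_signz -!big_split; apply: eq_bigr => v _ /=.
rewrite -!signzD; apply: (@eq_signz _ (1 - e (s u) - e (s v))); ring.
Qed.

Definition suspension_sign k (d : 'I_k.+1 -> int) : R[i] :=
  (-1) ^+ (k.+1 * k)./2 * desusp_sign R d.

(** The argument at position [a] is passed by the [k - a] desuspensions at later positions. *)
Lemma suspension_signE k (d : nat -> int) : suspension_sign (fun j : 'I_k.+1 => d j) =
  (-1) ^ ((k.+1 * k)./2%:Z + \sum_(a < k.+1) d a * (k%:Z - a%:Z)).
Proof.
rewrite /suspension_sign /desusp_sign signzD -exprnP; congr (_ * _).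
under eq_bigr do rewrite prod_signz.
rewrite prod_signz (exchange_big_dep xpredT) //=.
apply: (@eq_signz _ (- \sum_(a < k.+1) d a * (k%:Z - a%:Z))).
rewrite mulNr mulr_suml -sumrB; apply: eq_bigr => a _.
have -> : \sum_(b < k.+1 | (a < b)%N) -1 * d a = - d a * (k%:Z - a%:Z).
  have <- : \sum_(b < k.+1 | (a < b)%N) (1 : int) = k%:Z - a%:Z.
    have : \sum_(b < k.+1 | (b < k.+1)%N) (1 : int) = k.+1 by exact: sum_lt_ord.
    rewrite (bigID (fun b : 'I_k.+1 => (a < b)%N)) /=.
    under eq_bigl do rewrite ltn_ord /=.
    under [X in _ + X = _]eq_bigl do rewrite ltn_ord /= -leqNgt -ltnS.
    rewrite (@sum_lt_ord k.+1 a.+1) // => E; apply: (addIr (a.+1 : int)); rewrite E; lia.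
  by rewrite mulr_sumr; apply: eq_bigr => b _; rewrite mulN1r mulr1.
ring.
Qed.

Lemma sum_ordD (m n : nat) (f : nat -> int) :
  \sum_(a < m + n) f a = \sum_(a < m) f a + \sum_(a < n) f (m + a)%N.
Proof. by rewrite big_split_ord. Qed.

Lemma weighted_sum n (f : nat -> int) (c : int) :
  \sum_(a < n) f a * (c - a%:Z) =
  (\sum_(a < n) f a) * c - \sum_(a < n) f a * a%:Z.
Proof. by under eq_bigr do rewrite mulrBr; rewrite sumrB mulr_suml. Qed.

Lemma pext_ord n (s : 'S_n) (u : 'I_n) : pext s u = s u.
Proof. by rewrite /pext valK. Qed.

Lemma pext_ge n (s : 'S_n) j : (n <= j)%N -> pext s j = j.
Proof. by move=> nj; rewrite /pext insubF // ltnNge nj. Qed.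

(* The degrees of the arguments of the outer map, for an inner map of degree
   -1; compare outer_arg. *)
Definition outer_deg l i (s : 'S_(i + l)) (e : nat -> int) (j : nat) : int :=
  if (j < i)%N then e (pext s j)
  else if j == i then \sum_(u < l.+1) e (pext s (i + u)) - 1
  else e (j + l)%N.

(** The sign comparison for one shuffle term. Writing [k] as [i + r] cuts the arguments into the [i]
    before the slot, the [l.+1] inner ones and the [r] after it; all exponents become polynomials in
    sums over these blocks. *)
Lemma shift_sign_add l i r (s : 'S_(i + l)) (e : nat -> int) :
  let k := (i + r)%N in let p := (i + r + l)%N in
  koszul R s e * (-1) ^ (-1 * \sum_(j < i) e (pext s j))
  * (suspension_sign (fun j : 'I_k.+1 => outer_deg s e j)
     * suspension_sign (fun j : 'I_l.+1 => e (pext s (i + j)))) =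
  (-1) ^+ p * suspension_sign (fun j : 'I_p.+1 => e j)
  * (koszul R s (fun j => e j - 1) * (-1) ^+ s * (-1) ^ ((k%:Z - i%:Z - 1) * l%:Z)
     * (-1) ^ (l.+1%:Z * \sum_(j < i) (e (pext s j) - 1))).
Proof.
move=> k p; rewrite koszul_shift.
rewrite (@suspension_signE k (outer_deg s e)) (@suspension_signE p e).
rewrite (@suspension_signE l (fun j => e (pext s (i + j)))) (exprnP _ p).
(* X, Y, Z are the total degrees of the three blocks, X1, Y1, Z1 the same sums weighted by the
   position inside the block, and D is the weight of the unpermuted arguments. *)
pose f a := e (pext s a).
pose X : int := \sum_(a < i) f a; pose X1 : int := \sum_(a < i) f a * a%:Z.
pose Y : int := \sum_(u < l.+1) f (i + u)%N.
pose Y1 : int := \sum_(u < l.+1) f (i + u)%N * u%:Z.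
pose Z : int := \sum_(t < r) e (i + l.+1 + t)%N.
pose Z1 : int := \sum_(t < r) e (i + l.+1 + t)%N * t%:Z.
pose D : int := \sum_(a < p.+1) e a * (p%:Z - a%:Z).
have fE t : f (i + l.+1 + t)%N = e (i + l.+1 + t)%N.
  by rewrite /f pext_ge // addnS; lia.
have innerE : \sum_(a < l.+1) e (pext s (i + a)) * (l%:Z - a%:Z) = Y * l - Y1.
  exact: (weighted_sum _ (fun a => f (i + a)%N)).
have outerE : \sum_(a < k.+1) outer_deg s e a * (k%:Z - a%:Z) =
    X * k - X1 + (Y - 1) * r + (Z * (r%:Z - 1) - Z1).
  rewrite -[k.+1]addnS (@sum_ordD i r.+1 (fun a => outer_deg s e a * (k%:Z - a%:Z))).
  rewrite big_ord_recl -(weighted_sum i f).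
  rewrite -(weighted_sum r (fun t => e (i + l.+1 + t)%N)) addrA.
  congr (_ + _ + _).
  - by apply: eq_bigr => a _; rewrite /outer_deg ltn_ord.
  - rewrite /outer_deg addn0 ltnn eqxx; congr (_ * _); rewrite /k; lia.
  - apply: eq_bigr => t _; rewrite lift0 /outer_deg.
    rewrite ltnNge leq_addr /= -[X in _ == X]addn0 eqn_add2l /=.
    by congr (e _ * _); rewrite /k; lia.
have fullE : \sum_(a < p.+1) f a * (p%:Z - a%:Z) =
    X * p - X1 + (Y * (p%:Z - i%:Z) - Y1) + (Z * (r%:Z - 1) - Z1).
  have -> : p.+1 = (i + l.+1 + r)%N by rewrite /p; lia.
  rewrite !(sum_ordD _ _ (fun a => f a * (p%:Z - a%:Z))).
  rewrite -(weighted_sum i f) -(weighted_sum l.+1 (fun u => f (i + u)%N))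
    -(weighted_sum r (fun t => e (i + l.+1 + t)%N)).
  congr (_ + _ + _); apply: eq_bigr => u _.
  - congr (_ * _); lia.
  - rewrite fE; congr (_ * _); rewrite /p; lia.
(* Write [s u - u] as [(p - u) - (p - s u)] and reindex the second part by [s]; positions from
   [i + l] on are fixed by [s] and cancel. *)
have WE : \sum_(u < i + l) e (s u) * ((s u)%:Z - u%:Z) =
    \sum_(a < p.+1) f a * (p%:Z - a%:Z) - D.
  rewrite /D; have -> : p.+1 = (i + l + r.+1)%N by rewrite /p; lia.
  rewrite (sum_ordD _ _ (fun a => f a * (p%:Z - a%:Z))).
  rewrite (sum_ordD _ _ (fun a => e a * (p%:Z - a%:Z))).
  rewrite [X in _ - (X + _)](reindex_perm s) /= opprD addrACA.
  rewrite [X in _ + (X - _)](eq_bigr (fun t : 'I_r.+1 =>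
    e (i + l + t)%N * (p%:Z - (i + l + t)%N%:Z))).
    rewrite subrr addr0 -sumrB; apply: eq_bigr => u _.
    by rewrite /f pext_ord; ring.
  by move=> t _; rewrite /f pext_ge ?leq_addr.
rewrite innerE outerE WE fullE -/D -/X sumrB -/X sumr_const card_ord -mulr_natl mulr1 natz.
have TE : (p.+1 * p)./2%:Z = (k.+1 * k)./2%:Z + (l.+1 * l)./2%:Z + (k * l)%N%:Z :> int.
  have halfE n : ((n.+1 * n)./2 * 2 = n.+1 * n)%N by rewrite muln2 halfK oddM /= andNb subn0.
  have := halfE p; have := halfE k; have := halfE l; rewrite /p -/k.
  move: (_./2) (_./2) (_./2) => a b c; nia.
rewrite TE.
move: (koszul R s e) => q.
transitivity (q * (-1) ^ (
  -1 * X + ((k.+1 * k)./2%:Z + (X * k - X1 + (Y - 1) * r + (Z * (r%:Z - 1) - Z1)))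
  + ((l.+1 * l)./2%:Z + (Y * l - Y1)))).
  by rewrite !signzD; ring.
transitivity (q * (-1) ^ (p%:Z + ((k.+1 * k)./2%:Z + (l.+1 * l)./2%:Z + (k * l)%N%:Z + D)
 + (X * p - X1 + (Y * (p%:Z - i%:Z) - Y1) + (Z * (r%:Z - 1) - Z1) - D)
 + (k%:Z - i%:Z - 1) * l%:Z + l.+1%:Z * (X - i%:Z))); last first.
  by rewrite !signzD; ring.
congr (_ * _).
(* The witness is half the difference of the two exponents. *)
apply: (@eq_signz _ (- X * (1 + l%:Z) - r%:Z - r%:Z * l%:Z)).
rewrite /p /k; ring.
Qed.

Lemma shift_sign p k l i (s : 'S_(i + l)) (e : nat -> int) :
  (i <= k)%N -> (k + l = p)%N ->
  koszul R s e * (-1) ^ (-1 * \sum_(j < i) e (pext s j))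
  * (suspension_sign (fun j : 'I_k.+1 => outer_deg s e j)
     * suspension_sign (fun j : 'I_l.+1 => e (pext s (i + j)))) =
  (-1) ^+ p * suspension_sign (fun j : 'I_p.+1 => e j)
  * (koszul R s (fun j => e j - 1) * (-1) ^+ s * (-1) ^ ((k%:Z - i%:Z - 1) * l%:Z)
     * (-1) ^ (l.+1%:Z * \sum_(j < i) (e (pext s j) - 1))).
Proof.
move=> ik; move: (k - i)%N (subnKC ik) => r; clear ik => <- <-.
exact: shift_sign_add.
Qed.

Lemma suspension_sign_sq k (d : 'I_k.+1 -> int) :
  suspension_sign d * suspension_sign d = 1.
Proof.
have -> : suspension_sign d = suspension_sign (fun j : 'I_k.+1 => d (inord j)).
  by congr suspension_sign; apply/funext => j; rewrite inord_val.
by rewrite (@suspension_signE k (fun j => d (inord j))) signz_sq.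
Qed.

End ShiftSigns.

(** * Insertions with a zero argument and insertions of twisted maps *)

Section Insertion.
Variables (R : realType) (H : gradedModule R).

Lemma compose_substZ p k l (L : 'I_k -> {mpoly R[i][p]})
    (M : 'I_l -> {mpoly R[i][p]}) (F1 F2 : H -> pseries H k)
    (g1 g2 : pseries H l) (c : R[i]) m :
  (forall b a, F1 (g1 b) a = c *: F2 (g2 b) a) ->
  compose_subst L M F1 g1 m = c *: compose_subst L M F2 g2 m.
Proof.
move=> E; rewrite /compose_subst scaler_sumr; apply: eq_bigr => b _.
rewrite scaler_sumr; apply: eq_bigr => a _.
by rewrite E !scalerA mulrC.
Qed.

Variables (p k l i : nat) (s : 'S_(i + l)).
Variables (phi : cmap H k) (psi : cmap H l).
Hypotheses (mphi : multilinear phi) (mpsi : multilinear psi) (ik : (i <= k)%N).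
Implicit Type h : 'I_p.+1 -> H.

(** Presents the inner value as an update at a single index, the form in which multilinearity
    applies. *)
Lemma outer_argE h v :
  outer_arg s h v = [eta outer_arg s h 0 with inord i |-> v] :> ('I_k.+1 -> H).
Proof.
apply/funext => j /=; rewrite /outer_arg -val_eqE /= inordK //.
by case: (ltngtP j i).
Qed.

Lemma insertion_vanishing h m (j : 'I_p.+1) : (k + l = p)%N -> h j = 0 ->
  insertion s phi psi h m = 0.
Proof.
move=> klp hj; rewrite -[RHS](scale0r (insertion s phi psi h m)).
apply: compose_substZ => b a; rewrite scale0r.
have inner0 (t : nat) : (t <= l)%N -> pext s (i + t) = j ->
    phi (outer_arg s h (psi (fun j => h (inord (pext s (i + j)))) b)) a = 0.
  move=> tl tj; rewrite outer_argE; apply: (@multilinear0 _ _ _ _ _ (inord i)) => //=.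
  rewrite eqxx; apply: (@multilinear0 _ _ _ _ _ (inord t)) => //.
  by rewrite inordK // tj inord_val.
(* The zero argument is moved by the shuffle to an outer or inner position, or is the last inner
   argument [i + l], or is an outer argument after the slot. *)
case: (ltnP j (i + l)) => [jil|].
  pose u := (s^-1)%g (Ordinal jil).
  have uj : pext s u = j by rewrite pext_ord permKV.
  case: (ltnP u i) => [ui|iu].
    apply: (@multilinear0 _ _ _ _ _ (inord u)) => //.
    by rewrite /outer_arg inordK ?ui ?uj ?inord_val // ltnS; lia.
  apply: (inner0 (u - i)%N); last by rewrite subnKC.
  by have := ltn_ord u; lia.
rewrite leq_eqVlt => /orP[/eqP jE|jil].
  by apply: (inner0 l) => //; rewrite pext_ge.
have jp := ltn_ord j.
apply: (@multilinear0 _ _ _ _ _ (inord (j - l)%N)) => //.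
rewrite /outer_arg inordK; last by lia.
by rewrite ifF ?ifF ?subnK ?inord_val //; lia.
Qed.

(** As [psi] has degree -1, the inner value is homogeneous of the degree that [outer_deg] gives to
    slot [i]. Hence both twists act as scalars, the inner one leaving the slot by multilinearity. *)
Lemma insertion_twist c c' (d : 'I_p.+1 -> int) h m :
  homogeneous d h -> has_degree (-1) psi ->
  insertion s (twist c phi) (twist c' psi) h m =
  (c [ffun j : 'I_k.+1 => outer_deg s (fun j => d (inord j)) j]
   * c' [ffun j : 'I_l.+1 => d (inord (pext s (i + j)))]) *: insertion s phi psi h m.
Proof.
move=> dh psideg; apply: compose_substZ => b a.
set ih := fun j : 'I_l.+1 => h (inord (pext s (i + j))).
have idh : homogeneous [ffun j : 'I_l.+1 => d (inord (pext s (i + j)))] ih.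
  by move=> j; rewrite ffunE; exact: dh.
rewrite (twist_hom _ _ mpsi idh) outer_argE.
rewrite (multilinearZ _ _ _ _ _ (multilinear_twist _ mphi)) -outer_argE.
rewrite (@twist_hom _ _ _ _ _ [ffun j : 'I_k.+1 => outer_deg s (fun j => d (inord j)) j]) //.
  by rewrite scalerA mulrC.
move=> j; rewrite ffunE /outer_deg /outer_arg.
case: ifP => _; first exact: dh.
case: ifP => _; last exact: dh.
by have := psideg _ _ idh b; under eq_bigr do rewrite ffunE.
Qed.

End Insertion.

(** * Degrees of twisted and shifted maps *)

Section Degree.
Variables (R : realType) (G : gradedModule R).

Lemma has_degree_twist (H : gradedModule R) k c n (phi : cmap H k) :
  multilinear phi -> has_degree n phi -> has_degree n (twist c phi).
Proof.
move=> ml pd d h dh m.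
have dh' : homogeneous [ffun j => d j] h by move=> j; rewrite ffunE.
by rewrite (twist_hom _ _ ml dh'); apply: gcompZ; exact: pd.
Qed.

(* k + 1 arguments are shifted up by one each and the value by one, so degree
   k - 1 becomes -1. *)
Lemma has_degree_gshift k (phi : cmap G k) :
  @has_degree R G (k%:Z - 1) k phi <-> @has_degree R (gshift G) (-1) k phi.
Proof.
split=> pd d h dh m.
  have := pd (fun j => d j - 1) h dh m.
  rewrite sumrB sumr_const card_ord -mulr_natl mulr1 natz => pm.
  have -> : (\sum_j d j + -1) = (\sum_j d j - k.+1%:Z + (k%:Z - 1)) + 1 by lia.
  by rewrite /= addrK.
have dh' : @homogeneous R (gshift G) k.+1 (fun j => d j + 1) h.
  by move=> j; rewrite /= addrK; exact: dh.
have := pd _ h dh' m.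
rewrite big_split sumr_const card_ord -mulr_natl mulr1 natz /=.
by rewrite -!addrA; congr (gcomp (_ + _)); lia.
Qed.

End Degree.

(** * The suspension as an involution on families *)

Section Correspondence.
Variables (R : realType) (G : gradedModule R).
Implicit Types rho : Defs.family G.

Definition leib_sum rho n (d : 'I_n.+1 -> int) (x : 'I_n.+1 -> G) m : G :=
  \sum_(k < n.+1) \sum_(l < n.+1 | (k + l == n)%N)
  \sum_(i < k.+1) \sum_(s in shuffle i l)
    (koszul R s (fun j => d (inord j)) * (-1) ^+ s
     * (-1) ^ ((k%:Z - i%:Z - 1) * l%:Z)
     * (-1) ^ (l.+1%:Z * deg_before s d))
      *: @insertion R G n k l i s (rho k) (rho l) x m.

Definition diamond_term (H : gradedModule R) p k l n (phi : cmap H k)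
    (psi : cmap H l) (d : {ffun 'I_p.+1 -> int}) : cmap H p := fun h m =>
  \sum_(i < k.+1) \sum_(s in shuffle i l)
    (koszul R s (fun j => d (inord j)) * (-1) ^ (n * deg_before s d))
      *: insertion s phi psi h m.

Lemma vanishing_diamond_term (H : gradedModule R) p k l n (phi : cmap H k)
    (psi : cmap H l) : multilinear phi -> multilinear psi -> (k + l = p)%N ->
  vanishing (@diamond_term H p k l n phi psi).
Proof.
move=> mphi mpsi klp d h m j hj; rewrite /diamond_term.
rewrite big1 // => i _; rewrite big1 // => s _.
have ik : (i <= k)%N by rewrite -ltnS.
by rewrite (insertion_vanishing _ mphi mpsi ik _ klp hj) scaler0.
Qed.

(** [G] and [gshift G] share their carrier and [susp], [desusp] are identities, so this is a
    conversion. *)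
Lemma shifted_familyE rho k : shifted_family G rho k =
  @twist R (gshift G) k (fun d => suspension_sign R d) (rho k).
Proof. by []. Qed.

Lemma shifted_familyK rho : (forall k, multilinear (rho k)) ->
  shifted_family G (shifted_family G rho) = rho.
Proof.
move=> ml; apply: functional_extensionality_dep => k; rewrite !shifted_familyE.
exact: (@twistK R (gshift G) k _ (rho k) (ml k) (fun d => suspension_sign_sq R d)).
Qed.

Lemma shifted_family_sesquilinear rho k : conformal_sesquilinear (rho k) ->
  @conformal_sesquilinear R (gshift G) k (shifted_family G rho k).
Proof. exact: (@sesquilinear_twist R (gshift G)). Qed.

Lemma shifted_family_degree rho k : multilinear (rho k) ->
  @has_degree R (gshift G) (-1) k (rho k) ->
  @has_degree R (gshift G) (-1) k (shifted_family G rho k).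
Proof. exact: (@has_degree_twist R (gshift G)). Qed.

(** * The Leibniz identity against the bracket *)

Section Equation.
Variable rho : Defs.family G.
Arguments rho : clear implicits.
Hypothesis rho_sesq : forall k, conformal_sesquilinear (rho k).
Hypothesis rho_deg : forall k, @has_degree R G (k%:Z - 1) k (rho k).

Let ml k : multilinear (rho k). Proof. by have [] := rho_sesq k. Qed.
Arguments ml : clear implicits.
Let sml k : @multilinear R (gshift G) k (shifted_family G rho k).
Proof. exact: (multilinear_twist (H := gshift G) (fun d => suspension_sign R d) (ml k)). Qed.
Arguments sml : clear implicits.

(** [insertion_twist] extracts the suspension signs and [shift_sign] trades them; [d j - 1] is the
    degree of [h j] in [G]. *)
Lemma diamond_term_shifted p k l (d : {ffun 'I_p.+1 -> int}) (h : 'I_p.+1 -> G) m :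
  (k + l = p)%N -> @homogeneous R (gshift G) p.+1 d h ->
  @diamond_term (gshift G) p k l (-1) (shifted_family G rho k)
    (shifted_family G rho l) d h m =
  ((-1) ^+ p * suspension_sign R d) *:
  (\sum_(i < k.+1) \sum_(s in shuffle i l)
    (koszul R s (fun j => d (inord j) - 1) * (-1) ^+ s
     * (-1) ^ ((k%:Z - i%:Z - 1) * l%:Z)
     * (-1) ^ (l.+1%:Z * deg_before s (fun j => d j - 1)))
      *: @insertion R G p k l i s (rho k) (rho l) h m) :> G.
Proof.
move=> klp dh; rewrite /diamond_term scaler_sumr; apply: eq_bigr => i _.
rewrite scaler_sumr; apply: eq_bigr => s _.
have ik : (i <= k)%N by rewrite -ltnS.
have := shift_sign R s (fun j => d (inord j)) ik klp.
rewrite !shifted_familyE.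
rewrite (@insertion_twist R (gshift G) p k l i s (rho k) (rho l) (ml k) (ml l) ik _ _ d h m dh);
  last exact/has_degree_gshift.
have -> : suspension_sign R (fun j : 'I_p.+1 => d (inord j)) = suspension_sign R d.
  by congr suspension_sign; apply/funext => j; rewrite inord_val.
have -> : suspension_sign R [ffun j : 'I_k.+1 => outer_deg s (fun j => d (inord j)) j] =
    suspension_sign R (fun j : 'I_k.+1 => outer_deg s (fun j => d (inord j)) j).
  by congr suspension_sign; apply/funext => j; rewrite ffunE.
have -> : suspension_sign R [ffun j : 'I_l.+1 => d (inord (pext s (i + j)))] =
    suspension_sign R (fun j : 'I_l.+1 => d (inord (pext s (i + j)))).
  by congr suspension_sign; apply/funext => j; rewrite ffunE.
move=> E; rewrite scalerA [in RHS]scalerA; congr (_ *: _); exact: E.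
Qed.

(** Collects all pairs (k, l) under one [hom_extend], so that the comparison is made once per degree
    tuple. *)
Let diamond_sum p : {ffun 'I_p.+1 -> int} -> cmap (gshift G) p := fun d h m =>
  \sum_(k < p.+1) \sum_(l < p.+1 | (k + l == p)%N)
    @diamond_term (gshift G) p k l (-1) (shifted_family G rho k)
      (shifted_family G rho l) d h m.

Let diamond_sumE p (d : {ffun 'I_p.+1 -> int}) (h : 'I_p.+1 -> G) m :
  @homogeneous R (gshift G) p.+1 d h ->
  diamond_sum d h m =
  ((-1) ^+ p * suspension_sign R d) *: leib_sum rho (fun j => d j - 1) h m :> G.
Proof.
move=> dh; rewrite /diamond_sum /leib_sum scaler_sumr; apply: eq_bigr => k _.
rewrite scaler_sumr; apply: eq_bigr => l /eqP klp.
exact: diamond_term_shifted.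
Qed.

Let vanishing_diamond_sum p : vanishing (@diamond_sum p).
Proof.
move=> d h m j hj; rewrite /diamond_sum big1 // => k _; rewrite big1 // => l /eqP klp.
exact: (vanishing_diamond_term _ (sml k) (sml l) klp _ _ hj).
Qed.

(** In degree -1 the bracket is symmetric: its second half is the first with [k] and [l]
    exchanged. *)
Let bracketE p h m :
  @bracket R (gshift G) (-1) (-1) (shifted_family G rho) (shifted_family G rho) p h m =
  (hom_extend (@diamond_sum p) h m) *+ 2.
Proof.
have -> : hom_extend (@diamond_sum p) h m =
    \sum_(k < p.+1) \sum_(l < p.+1 | (k + l == p)%N)
      @diamond R (gshift G) p k l (-1) (shifted_family G rho k)
        (shifted_family G rho l) h m.
  rewrite (hom_extend_on _ (@vanishing_diamond_sum p) (@hsupp_finite _ _ _ h)) //.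
  rewrite exchange_big; apply: eq_bigr => k _ /=.
  rewrite exchange_big; apply: eq_bigr => l /= /eqP klp.
  rewrite /diamond -(hom_extend_on _ (vanishing_diamond_term _ (sml k) (sml l) klp)) //.
  exact: hsupp_finite.
rewrite /bracket mulr2n.
under eq_bigr do under eq_bigr do rewrite -scaleNr mulrNN mulr1 expr1z opprK scale1r.
under eq_bigr do rewrite big_split.
rewrite big_split /=; congr (_ + _).
rewrite (exchange_big_dep xpredT) //=; apply: eq_bigr => k _.
by apply: eq_bigl => l; rewrite addnC.
Qed.

Lemma leib_bracket :
  (forall n (d : 'I_n.+1 -> int) (x : 'I_n.+1 -> G), homogeneous d x ->
     forall m, leib_sum rho d x m = 0) <->
  (forall p h m, @bracket R (gshift G) (-1) (-1) (shifted_family G rho)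
     (shifted_family G rho) p h m = 0).
Proof.
split=> [leib p h m|mc n d x dx m].
  rewrite bracketE (hom_extend_on _ (@vanishing_diamond_sum p) (@hsupp_finite _ _ _ h)) //.
  rewrite big1 ?mul0rn // => d _.
  have dh : @homogeneous R (gshift G) p.+1 d (fun j => @hcomp R (gshift G) (d j) (h j)).
    by move=> j; have [] := @hcompP R (gshift G) (h j).
  by rewrite (diamond_sumE _ dh) leib ?scaler0.
have dx' : @homogeneous R (gshift G) n.+1 [ffun j => d j + 1] x.
  by move=> j; rewrite ffunE /= addrK; exact: dx.
(* The factor 2 is cancelled in characteristic 0; homogeneous arguments then single out one degree
   tuple. *)
have := mc n x m; rewrite bracketE -scaler_nat => /eqP.
rewrite scaler_eq0 pnatr_eq0 /= => /eqP.
rewrite (hom_extend_hom _ (@vanishing_diamond_sum n) dx') (diamond_sumE _ dx').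
(* The scalar is its own inverse, so multiplying by it again removes it. *)
move=> /(congr1 (fun y : G => ((-1) ^+ n * suspension_sign R [ffun j => d j + 1]) *: y)).
rewrite scaler0 scalerA mulrACA suspension_sign_sq mulr1 -exprD addnn -signr_odd odd_double.
rewrite expr0 scale1r => <-; congr leib_sum.
by apply/funext => j; rewrite ffunE addrK.
Qed.

End Equation.
End Correspondence.

Theorem theorem3p9 (R : realType) (G : gradedModule R) :
  set_bij (LeibInfConformal G) (MaurerCartan (gshift G))
    (shifted_family G).
Proof.
split.
- move=> rho [rhoC leib].
  have sesq k : conformal_sesquilinear (rho k) by have [] := rhoC k.
  have deg k : @has_degree R G (k%:Z - 1) k (rho k) by have [] := rhoC k.
  split; last exact/(leib_bracket sesq deg).
  move=> k; split; first exact: shifted_family_sesquilinear.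
  by apply: shifted_family_degree; [have [] := sesq k | exact/has_degree_gshift].
- move=> rho1 rho2 /set_mem[C1 _] /set_mem[C2 _] E.
  rewrite -(shifted_familyK (rho := rho1)); last by move=> k; have [[]] := C1 k.
  by rewrite E shifted_familyK // => k; have [[]] := C2 k.
move=> phi [phiC mc].
have sesq k : @conformal_sesquilinear R G k (phi k) by have [] := phiC k.
have ml k : @multilinear R G k (phi k) by have [] := sesq k.
(* By involutivity the preimage of [phi] is its own shift, read as a family on [G]. *)
pose rho : Defs.family G := shifted_family G phi.
have rhosesq k : @conformal_sesquilinear R G k (rho k).
  exact: (@shifted_family_sesquilinear R G phi).
have rhodeg k : @has_degree R G (k%:Z - 1) k (rho k).
  by apply/has_degree_gshift/shifted_family_degree => //; have [] := phiC k.
have rhoK : shifted_family G rho = phi by exact: shifted_familyK.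
exists rho => //; split=> [k|]; first by split.
by apply/(leib_bracket rhosesq rhodeg); rewrite rhoK.
Qed.
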